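(* Let $d,k\ge1$ be integers, $G,R>0$, and $\Theta=\{\theta\in\mathbb R^d:\|\theta\|_1\le R\}$. Then $$\epsilon_k^*(\mathcal F_{G,\infty},\Theta)\ \ge\ \frac1{24}\,\frac{GR}{\sqrt k}\,\min\left\{\frac{\sqrt k}{\sqrt{\log(3k)}},\ \frac{\sqrt d}{\sqrt{\log(3d)}}\right\}.$$
   Context: $\mathcal F_{G,\infty}$ is the collection of pairs $(F,P)$ where $F(\theta;x)=\langle\theta,x\rangle$ for $\theta,x\in\mathbb R^d$ and $P$ is a probability distribution on $\mathbb R^d$ with $\mathbb E_P[\|X\|_\infty^2]\le G^2$. For such a pair, $f(\theta)=\mathbb E_P[F(\theta;X)]$. $\mathcal A_k$ is the class of all (possibly randomized) algorithms that, at each iteration $t=1,\dots,k$, choose a pair of query points $\theta^t,\tau^t\in\mathbb R^d$ as a function of the previous observations and internal randomness, then observe $Y^t=[F(\theta^t;X^t)\ \ F(\tau^t;X^t)]\in\mathbb R^2$, where $X^1,X^2,\dots$ are i.i.d. from $P$ (and independent of the internal randomness), and after $k$ iterations output a point $\widehat\theta(k)\in\Theta$. The minimax error is $$\epsilon_k^*(\mathcal F,\Theta)=\inf_{\mathcal A\in\mathcal A_k}\ \sup_{(F,P)\in\mathcal F}\ \mathbb E\Big[f(\widehat\theta(k))-\inf_{\theta\in\Theta}f(\theta)\Big],$$ the expectation being over the observations and the algorithm's randomness. *)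

(* Defs.v *)
From HB Require Import structures.
From mathcomp Require Import all_boot all_order all_algebra.
From mathcomp Require Import all_classical all_reals all_analysis.

Set Implicit Arguments.
Unset Strict Implicit.
Unset Printing Implicit Defensive.

Import Order.TTheory GRing.Theory Num.Theory.
Import numFieldNormedType.Exports.

Local Open Scope classical_set_scope.
Local Open Scope ring_scope.

(* R^d is [d.-tuple R], whose canonical sigma-algebra is the one generated by
   the coordinates, i.e. the Borel one. *)

Section Vectors.
Context {R : realType} {d : nat}.

Definition inner (theta x : d.-tuple R) : R :=
  \sum_(i < d) tnth theta i * tnth x i.

Definition norm1 (theta : d.-tuple R) : R := \sum_(i < d) `|tnth theta i|.

Definition norm_infty (x : d.-tuple R) : R :=
  \big[Num.max/0]_(i < d) `|tnth x i|.

End Vectors.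

Definition l1_ball {R : realType} (d : nat) (r : R) : set (d.-tuple R) :=
  [set theta | norm1 theta <= r].
Arguments l1_ball {R} d r _.

Section IidSample.
Context {R : realType} {disp : measure_display} {T : measurableType disp}.

Definition tcons n (p : T * n.-tuple T) : n.+1.-tuple T := [tuple of p.1 :: p.2].

Lemma measurable_tcons n : measurable_fun [set: T * n.-tuple T] (@tcons n).
Proof. exact: measurable_cons measurable_fst measurable_snd. Qed.

HB.instance Definition _ n :=
  isMeasurableFun.Build _ _ _ _ (@tcons n) (@measurable_tcons n).

(* The n-fold product measure of P, i.e. the law of (X^1, ..., X^n) i.i.d. *)
Fixpoint iid (P : probability T R) (n : nat) : probability (n.-tuple T) R :=
  match n return probability (n.-tuple T) R with
  | 0 => dirac [tuple]
  | n'.+1 => distribution (P \x iid P n')%E (@tcons n')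
  end.

End IidSample.

Section Minimax.
Context {R : realType} {d : nat}.
Notation vec := (d.-tuple R).

Definition objective (F : vec -> vec -> R) (P : probability vec R)
  (theta : vec) : \bar R := 'E_P[F theta].

(* The whole internal randomness is a single draw from seed_law, available at
   every iteration. With iterations numbered from 0, query t sees the seed and
   the t earlier observations, in chronological order. The members query t
   with k <= t never enter expected_gap. *)
Record algorithm (k : nat) (Theta : set vec) := Algorithm {
  seed_display : measure_display ;
  seed : measurableType seed_display ;
  seed_law : probability seed R ;
  query : forall t : nat, seed * t.-tuple (R * R) -> vec * vec ;
  measurable_query : forall t : nat, measurable_fun setT (@query t) ;
  output : seed * k.-tuple (R * R) -> vec ;
  measurable_output : measurable_fun setT output ;
  output_in : forall z, Theta (output z)
}.

#[global] Arguments query {k Theta} _ {t} _.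
#[global] Arguments measurable_query {k Theta} _ t.
#[global] Arguments output {k Theta} _ _.
#[global] Arguments measurable_output {k Theta} _.
#[global] Arguments output_in {k Theta} _ z.

Section Run.
Variables (k : nat) (Theta : set vec) (A : algorithm k Theta).
Variable F : vec -> vec -> R.

Fixpoint observations (u : seed A) (x : nat -> vec) (t : nat)
    : t.-tuple (R * R) :=
  match t return t.-tuple (R * R) with
  | 0 => [tuple]
  | t'.+1 => let y := observations u x t' in
             let q := query A (u, y) in
             [tuple of rcons y (F q.1 (x t'), F q.2 (x t'))]
  end.

(* The default value of nth is never read: only the samples x_0, ..., x_(k-1)
   are used. *)
Definition estimate (w : seed A * k.-tuple vec) : vec :=
  output A (w.1, observations w.1 (nth [tuple of nseq d 0] w.2) k).

Definition expected_gap (P : probability vec R) : \bar R :=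
  (\int[seed_law A \x iid P k]_w
     (objective F P (estimate w) - ereal_inf (objective F P @` Theta)))%E.

End Run.

(* An existential rather than an image set: universe constraints exclude
   [set: algorithm k Theta]. *)
Definition minimax_error (k : nat)
    (Fam : set ((vec -> vec -> R) * probability vec R)) (Theta : set vec)
    : \bar R :=
  ereal_inf [set e | exists A : algorithm k Theta,
    e = ereal_sup [set expected_gap A FP.1 FP.2 | FP in Fam]].

Definition family_G_infty (G : R)
    : set ((vec -> vec -> R) * probability vec R) :=
  [set FP | FP.1 = inner /\
            ('E_(FP.2)[(fun x => norm_infty x ^+ 2)%R] <= (G ^+ 2)%:E)%E].

End Minimax.

(* Main.v *)
(** Let m = min(k, d), s = G / (3 sqrt(ln(3m))), delta = s sqrt(m/k) / 4, and let
    P_v be the law of delta v + s Z for v = +-e_j, j < m, with Z standard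
    Gaussian in the first m coordinates. The ln(3m) in s pays for the expected
    maximum of the squares of m Gaussians, so P_v meets the moment constraint.
    Two linear measurements of X only see the projection w_v of delta v onto the
    span of the two queries, and the |w_v|^2 for v = e_1, ..., e_m add up to at
    most 2 delta^2. By Cameron-Martin and Jensen, one iteration satisfies
      exp(E_0 g(Y) - |w_v|^2 / (2 s^2)) <= E_v exp(g(Y)),
    and this iterates over the k adaptive rounds (a variational form of the chain
    rule for the relative entropy). With g = <theta^, v> / (4r), bounded by 1/4,
    and summed over the 2m vectors v, for which the terms E_0 <theta^, v> cancel,
    it shows that the mean over v of E_v <theta^, v> is at least -r/2. Hence some
    P_v has expected gap at least delta r / 2, which is the claimed bound. *)

From HB Require Import structures.
Require Import Defs.
From mathcomp Require Import all_boot all_order all_algebra.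
From mathcomp Require Import all_classical all_reals all_analysis.
From mathcomp Require Import measurable_realfun ring lra.

Set Implicit Arguments.
Unset Strict Implicit.
Unset Printing Implicit Defensive.

Import Order.TTheory GRing.Theory Num.Theory.
Import numFieldNormedType.Exports.

Local Open Scope classical_set_scope.
Local Open Scope ring_scope.

(** * Bounded measurable functions and i.i.d. samples *)

(** Under a probability such functions are integrable and the class is stable under sections,
    partial integrals and exponentials, so the information argument can run on real-valued
    integrals. *)
Definition bounded_measurable {R : realType} {d} {T : measurableType d}
    (f : T -> R) :=
  measurable_fun setT f /\ exists M, forall x, `|f x| <= M.

Section BoundedMeasurable.
Context {R : realType} {d} {T : measurableType d}.
Implicit Types f g : T -> R.

Lemma bounded_measurable_cst (c : R) : bounded_measurable (fun _ : T => c).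
Proof. by split; [exact: measurable_cst|exists `|c|]. Qed.

Lemma bounded_measurableD f g : bounded_measurable f -> bounded_measurable g ->
  bounded_measurable (fun x => f x + g x).
Proof.
move=> [mf [M fM]] [mg [N gN]]; split; first exact: measurable_funD.
by exists (M + N) => x; rewrite (le_trans (ler_normD _ _))// lerD.
Qed.

Lemma bounded_measurableM f g : bounded_measurable f -> bounded_measurable g ->
  bounded_measurable (fun x => f x * g x).
Proof.
move=> [mf [M fM]] [mg [N gN]]; split; first exact: measurable_funM.
by exists (M * N) => x; rewrite normrM ler_pM.
Qed.

Lemma bounded_measurable_sum (I : Type) (r : seq I) (F : I -> T -> R) :
  (forall i, bounded_measurable (F i)) ->
  bounded_measurable (fun x => \sum_(i <- r) F i x).
Proof.
move=> bF; elim: r => [|i r IH].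
  by under eq_fun do rewrite big_nil; exact: bounded_measurable_cst.
by under eq_fun do rewrite big_cons; exact: bounded_measurableD.
Qed.

Lemma bounded_measurable_expR f : bounded_measurable f ->
  bounded_measurable (fun x => expR (f x)).
Proof.
move=> [mf [M fM]]; split; first exact: measurableT_comp.
exists (expR M) => x; rewrite ger0_norm ?expR_ge0// ler_expR.
exact: le_trans (ler_norm _) (fM x).
Qed.

Lemma bounded_measurable_comp {d'} {T' : measurableType d'} (h : T' -> T) f :
  measurable_fun setT h -> bounded_measurable f ->
  bounded_measurable (fun x => f (h x)).
Proof.
by move=> mh [mf [M fM]]; split; [exact: measurableT_comp|exists M].
Qed.

Variable P : probability T R.

Lemma bounded_measurable_integrable f : bounded_measurable f ->
  P.-integrable setT (EFin \o f).
Proof.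
move=> [mf [M fM]]; apply: measurable_bounded_integrable => //.
  by rewrite (le_lt_trans (probability_le1 P measurableT))// ltry.
exists M; split; first exact: num_real.
by move=> N MN x _; exact: le_trans (fM x) (ltW MN).
Qed.

Lemma Rintegral_prob_cst (c : R) : \int[P]_x c = c.
Proof.
rewrite Rintegral_cst// -[RHS]mulr1; congr (_ * _).
by have /(congr1 fine) := probability_setT P.
Qed.

Lemma le_Rintegral_prob f g : bounded_measurable f -> bounded_measurable g ->
  (forall x, f x <= g x) -> \int[P]_x f x <= \int[P]_x g x.
Proof.
move=> bf bg fg.
by apply: le_Rintegral => //; exact: bounded_measurable_integrable.
Qed.

Lemma RintegralD_prob f g : bounded_measurable f -> bounded_measurable g ->
  \int[P]_x (f x + g x) = \int[P]_x f x + \int[P]_x g x.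
Proof.
by move=> bf bg; apply: RintegralD => //; exact: bounded_measurable_integrable.
Qed.

Lemma RintegralZ_prob f (c : R) : bounded_measurable f ->
  \int[P]_x (c * f x) = c * \int[P]_x f x.
Proof.
by move=> bf; apply: RintegralZl => //; exact: bounded_measurable_integrable.
Qed.

Lemma Rintegral_sum_prob (I : Type) (r : seq I) (F : I -> T -> R) :
  (forall i, bounded_measurable (F i)) ->
  \int[P]_x (\sum_(i <- r) F i x) = \sum_(i <- r) \int[P]_x F i x.
Proof.
move=> bF; elim: r => [|i r IH].
  under eq_Rintegral do rewrite big_nil.
  by rewrite big_nil Rintegral_prob_cst.
under eq_Rintegral do rewrite big_cons.
by rewrite big_cons RintegralD_prob ?IH//; exact: bounded_measurable_sum.
Qed.

Lemma Rintegral_prob_bound f (M : R) : bounded_measurable f ->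
  (forall x, `|f x| <= M) -> `|\int[P]_x f x| <= M.
Proof.
move=> bf fM; rewrite ler_norml.
rewrite -[- M]Rintegral_prob_cst -{2}[M]Rintegral_prob_cst.
have bc c := bounded_measurable_cst c.
by apply/andP; split; apply: le_Rintegral_prob => // x; have := fM x;
  rewrite ler_norml => /andP[].
Qed.

Lemma EFin_Rintegral_prob f : bounded_measurable f ->
  (\int[P]_x f x)%:E = (\int[P]_x (f x)%:E)%E.
Proof.
move=> bf; rewrite fineK//.
exact: integrable_fin_num (bounded_measurable_integrable bf).
Qed.

End BoundedMeasurable.

Lemma Rintegral_distribution {R : realType} {d d'}
    {T : measurableType d} {T' : measurableType d'} (P : probability T R)
    (X : {mfun T >-> T'})
    (f : T' -> R) : bounded_measurable f ->
  \int[distribution P X]_y f y = \int[P]_x f (X x).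
Proof.
move=> bf; rewrite /Rintegral integral_distribution//.
  by apply/measurable_EFinP; case: bf.
apply: bounded_measurable_integrable; apply: bounded_measurable_comp => //.
Qed.

(** * Fubini for bounded measurable functions *)

Section Product.
Context {R : realType} {d1 d2} {T1 : measurableType d1} {T2 : measurableType d2}.
Variables (P : probability T1 R) (Q : probability T2 R).

Lemma bounded_measurable_section (f : T1 * T2 -> R) x :
  bounded_measurable f -> bounded_measurable (fun y => f (x, y)).
Proof. by apply: bounded_measurable_comp; exact: pair1_measurable. Qed.

Lemma bounded_measurable_Rintegral (f : T1 * T2 -> R) : bounded_measurable f ->
  bounded_measurable (fun x => \int[Q]_y f (x, y)).
Proof.
move=> bf; split; last first.
  case: (bf) => _ [M fM]; exists M => x.
  by apply: Rintegral_prob_bound => //; exact: bounded_measurable_section.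
have [mf [M fM]] := bf.
have bsec x := bounded_measurable_section x bf.
have bM := @bounded_measurable_cst R _ T2 M.
(* Adding the bound [M] makes the integrand nonnegative, so that the Tonelli measurability statement
   applies; [M] is subtracted afterwards. *)
rewrite (_ : (fun x => _) =
    fun x => fine (fubini_F Q (fun z => (f z + M)%:E) x) - M).
  apply: measurable_funB; last exact: measurable_cst.
  apply: measurableT_comp => //; apply: measurable_fun_fubini_tonelli_F => //.
    by apply/measurable_EFinP; apply: measurable_funD.
  move=> z; rewrite lee_fin -lerBlDr sub0r.
  by have := fM z; rewrite ler_norml => /andP[].
apply/funext => x; rewrite -[fine _]/(\int[Q]_y (f (x, y) + M)).
by rewrite RintegralD_prob// Rintegral_prob_cst addrK.
Qed.

Lemma Rintegral_prod (f : T1 * T2 -> R) : bounded_measurable f ->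
  \int[(P \x Q)%E]_z f z = \int[P]_x \int[Q]_y f (x, y).
Proof.
move=> bf; rewrite /Rintegral.
rewrite -integral12_prod_meas1; last first.
  exact: (@bounded_measurable_integrable _ _ _ (P \x Q)%E).
congr fine; apply: eq_integral => x _.
by rewrite /fubini_F EFin_Rintegral_prob//; exact: bounded_measurable_section.
Qed.

End Product.

Section Iid.
Context {R : realType} {d} {T : measurableType d}.
Variable P : probability T R.

Lemma Rintegral_iidS n (f : n.+1.-tuple T -> R) : bounded_measurable f ->
  \int[iid P n.+1]_xs f xs =
  \int[P]_x \int[iid P n]_xs f [tuple of x :: xs].
Proof.
move=> bf; rewrite Rintegral_distribution// Rintegral_prod//.
by apply: bounded_measurable_comp => //; exact: measurable_tcons.
Qed.

Lemma Rintegral_iid0 (f : 0.-tuple T -> R) : \int[iid P 0]_xs f xs = f [tuple].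
Proof.
rewrite -[RHS](Rintegral_prob_cst (iid P 0)).
by apply: eq_Rintegral => xs _; rewrite (tuple0 xs).
Qed.

Lemma measurable_rcons {d1} {S : measurableType d1} (f : S -> T) n
    (g : S -> n.-tuple T) :
  measurable_fun setT f -> measurable_fun setT g ->
  measurable_fun setT (fun x => [tuple of rcons (g x) (f x)] : n.+1.-tuple T).
Proof.
move=> mf mg; apply/measurable_fun_tnthP => i.
have [ilt|ige] := ltnP i n.
  rewrite (_ : _ \o _ = fun x => tnth (g x) (Ordinal ilt)).
    by apply: (measurableT_comp (measurable_tnth (Ordinal ilt))).
  apply/funext => x /=; rewrite (tnth_nth (f x)) /= nth_rcons size_tuple ilt.
  by rewrite (tnth_nth (f x)).
rewrite (_ : _ \o _ = f)//.
apply/funext => x /=; rewrite (tnth_nth (f x)) /= nth_rcons size_tuple ltnNge ige.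
by case: ifP.
Qed.

(** [iid] prepends draws whereas [observations] appends them; isolating the last draw is what lets
    the last round be treated conditionally on the earlier ones. The induction peels off the first
    draw on both sides. *)
Lemma Rintegral_iid_rcons n (f : n.+1.-tuple T -> R) : bounded_measurable f ->
  \int[iid P n.+1]_xs f xs =
  \int[iid P n]_xs \int[P]_x f [tuple of rcons xs x].
Proof.
elim: n f => [|n IH] f bf.
  rewrite Rintegral_iidS// Rintegral_iid0; apply: eq_Rintegral => x _.
  by rewrite Rintegral_iid0; congr f; apply/val_inj.
have bfr : bounded_measurable
    (fun z : n.+1.-tuple T * T => f [tuple of rcons z.1 z.2]).
  by apply: bounded_measurable_comp => //; exact: measurable_rcons.
rewrite Rintegral_iidS// Rintegral_iidS; last first.
  exact: (bounded_measurable_Rintegral P bfr).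
apply: eq_Rintegral => x _; rewrite IH.
  apply: eq_Rintegral => xs _; apply: eq_Rintegral => x' _.
  by congr f; apply/val_inj.
apply: bounded_measurable_comp bf.
by apply: measurable_cons => //; exact: measurable_cst.
Qed.

End Iid.

(** * The standard Gaussian law and its shifts *)

Section Density.
Import HBNNSimple.

(** The hypothesis on [nu] is the case of indicators; linearity extends it to simple functions
    ([step]), and monotone convergence to nonnegative measurable ones. *)
Lemma ge0_integral_density {R : realType} {d} {T : measurableType d}
    (mu nu : {measure set T -> \bar R}) (p : T -> R) (f : T -> \bar R) :
  measurable_fun setT p -> (forall x, 0 <= p x) ->
  (forall A, measurable A -> nu A = (\int[mu]_(x in A) (p x)%:E)%E) ->
  measurable_fun setT f -> (forall x, 0 <= f x)%E ->
  (\int[nu]_x f x = \int[mu]_x (f x * (p x)%:E))%E.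
Proof.
move=> mp p0 nuE mf f0.
have mpE : measurable_fun setT (EFin \o p) by exact/measurable_EFinP.
pose f_ := nnsfun_approx measurableT mf.
have f_cvg x : ((f_ n x)%:E @[n --> \oo] --> f x)%E.
  by apply: cvg_nnsfun_approx.
have f_nd x : {homo (fun n => f_ n x) : m n / (m <= n)%N >-> m <= n}.
  by move=> m n mn; exact/lefP/nd_nnsfun_approx.
have step n : (\int[nu]_x (f_ n x)%:E = \int[mu]_x ((f_ n x)%:E * (p x)%:E))%E.
  have f_E x : (f_ n x)%:E = (\sum_(r \in range (f_ n))
      (r * \1_(f_ n @^-1` [set r]) x)%:E)%E.
    by rewrite fsumEFin// -fimfunE.
  transitivity (\int[nu]_x (\sum_(r \in range (f_ n))
      (r * \1_(f_ n @^-1` [set r]) x)%:E))%E.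
    by apply: eq_integral => x _; rewrite f_E.
  transitivity (\int[mu]_x (\sum_(r \in range (f_ n))
      (r * \1_(f_ n @^-1` [set r]) x)%:E * (p x)%:E))%E; last first.
    apply: eq_integral => x _; rewrite -ge0_mule_fsuml ?f_E// => r.
    exact: nnfun_muleindic_ge0.
  have m1 r : measurable_fun setT
      (fun x => (r * \1_(f_ n @^-1` [set r]) x)%:E).
    by apply/measurable_EFinP; exact: measurable_funM.
  rewrite !ge0_integral_fsum//; last 3 first.
  - by move=> r; apply: emeasurable_funM.
  - by move=> r x _; rewrite mule_ge0 ?nnfun_muleindic_ge0 ?lee_fin.
  - by move=> r x _; rewrite nnfun_muleindic_ge0.
  apply: eq_fsbigr => r /[!inE] -[t _ rE].
  have r0 : 0 <= r by rewrite -rE.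
  under eq_integral do rewrite EFinM.
  rewrite ge0_integralZl//; last exact/measurable_EFinP.
  rewrite integral_indic// setIT nuE//.
  under [RHS]eq_integral do rewrite EFinM -muleA.
  rewrite ge0_integralZl//; last 2 first.
  - by apply: emeasurable_funM => //; exact/measurable_EFinP.
  - by move=> x _; rewrite mule_ge0 ?lee_fin.
  congr (_ * _)%E; rewrite integral_mkcond/=.
  apply: eq_integral => x _; rewrite patchE indicE.
  by case: ifP => _; rewrite ?mul1e ?mul0e.
transitivity (limn (fun n => \int[nu]_x (f_ n x)%:E))%E.
  rewrite -monotone_convergence//.
  - by apply: eq_integral => x _; apply/esym/cvg_lim => //; exact: f_cvg.
  - by move=> n; exact/measurable_EFinP.
  - by move=> n x _; rewrite lee_fin.
  - by move=> x _ m n mn; rewrite lee_fin; exact: f_nd.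
under eq_fun do rewrite step.
rewrite -monotone_convergence//.
- apply: eq_integral => x _; apply/cvg_lim => //.
  by apply: cvgeZr => //; exact: f_cvg.
- by move=> n; apply: emeasurable_funM => //; exact/measurable_EFinP.
- by move=> n x _; rewrite mule_ge0 ?lee_fin.
- by move=> x _ m n mn; rewrite lee_wpmul2r ?lee_fin//; exact: f_nd.
Qed.

End Density.


(** The translated measure gives every half-open interval its length, so uniqueness of Lebesgue
    measure identifies the two. *)
Lemma ge0_integral_lebesgue_shift {R : realType} (a : R)
    (f : measurableTypeR R -> \bar R) :
  measurable_fun setT f -> (forall x, 0 <= f x)%E ->
  (\int[lebesgue_measure]_x f ((x : R) + a)%R = \int[lebesgue_measure]_x f x)%E.
Proof.
move=> mf f0.
have mshift : measurable_fun setT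
    (fun x : measurableTypeR R => (x : R) + a : measurableTypeR R).
  by apply: measurable_funD => //; exact: measurable_cst.
pose X : {mfun measurableTypeR R >-> measurableTypeR R} := HB.pack
  (fun x : measurableTypeR R => (x : R) + a : measurableTypeR R)
  (isMeasurableFun.Build _ _ _ _ _ mshift).
transitivity (\int[pushforward lebesgue_measure X]_x f x)%E.
  by rewrite ge0_integral_pushforward.
apply: eq_measure_integral => A mA _.
apply/esym/(@lebesgue_measure_unique R (pushforward lebesgue_measure X)) => //.
move=> _ [[b c] /= bc <-].
rewrite /pushforward (_ : _ @^-1` _ = `]b - a, c - a]%classic); last first.
  by apply/seteqP; split => x /=; rewrite !in_itv/= ltrBlDr lerBrDr.
rewrite !lebesgue_measure_itv/= !lte_fin ltrD2r.
by case: ifP => // _; rewrite -!EFinB opprB addrA subrK.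
Qed.

Section Gauss.
Context {R : realType}.

Let embed : measurableTypeR R -> R := idfun.

Let measurable_embed : measurable_fun setT embed.
Proof. exact: (@measurable_id _ _ setT). Qed.

HB.instance Definition _ :=
  @isMeasurableFun.Build _ _ _ _ embed measurable_embed.

(* The carriers agree, but [normal_prob] lives on the copy of R with the
   display of half-open intervals. *)
Definition gauss : probability R R := distribution (normal_prob 0 1) embed.

Lemma ge0_integral_gauss (f : R -> \bar R) :
  measurable_fun setT f -> (forall x, 0 <= f x)%E ->
  (\int[gauss]_x f x =
   \int[lebesgue_measure]_x (f x * (normal_pdf 0 1 x)%:E))%E.
Proof.
move=> mf f0; rewrite ge0_integral_distribution//.
apply: (@ge0_integral_density _ _ (measurableTypeR R)) => //.
- exact: measurable_normal_pdf.
- exact: normal_pdf_ge0.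
Qed.

Lemma normal_pdf01 (x : R) :
  normal_pdf 0 1 x = normal_peak 1 * expR (- (x ^+ 2) / 2).
Proof. by rewrite normal_pdfE ?oner_eq0// /normal_fun subr0 expr1n. Qed.

(** The integrand times the Gaussian density is [sqrt 2] times the density of variance 2, so the
    integral is exactly [sqrt 2]. *)
Lemma expR_sqr_gauss : (\int[gauss]_x (expR ((x : R) ^+ 2 / 4))%:E <= 2%:E)%E.
Proof.
rewrite ge0_integral_gauss; last 2 first.
- apply/measurable_EFinP; apply: measurableT_comp => //.
  by apply: measurable_funM => //; exact: measurable_funX.
- by move=> x; rewrite lee_fin expR_ge0.
have s2 : Num.sqrt (2 : R) != 0 by rewrite gt_eqF// sqrtr_gt0.
rewrite (_ : (fun x : R => _) = fun x =>
    ((Num.sqrt 2)%:E * (normal_pdf 0 (Num.sqrt 2) x)%:E)%E); last first.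
  apply/funext => x; rewrite -!EFinM normal_pdf01 normal_pdfE//; congr _%:E.
  rewrite /normal_peak /normal_fun subr0 sqr_sqrtr// expr1n mul1r.
  rewrite -[2 * pi *+ 2]mulrnAr.
  rewrite (sqrtrM (pi *+ 2)) ?ler0n// invfM !mulrA mulfV// mul1r.
  rewrite [expR _ * _]mulrC -mulrA -expRD; congr (_ * expR _).
  by field.
rewrite ge0_integralZl//; last 2 first.
- by apply/measurable_EFinP; exact: measurable_normal_pdf.
- by move=> x _; rewrite lee_fin normal_pdf_ge0.
rewrite integral_normal_pdf mule1 lee_fin.
rewrite -(@ler_pXn2r _ 2) ?nnegrE ?sqrtr_ge0// sqr_sqrtr//; lra.
Qed.

(** Completing the square turns the weighted density into that of mean [a] and variance 1. *)
Lemma exp_moment_gauss (a : R) :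
  (\int[gauss]_x (expR (a * x - a ^+ 2 / 2))%:E = 1)%E.
Proof.
rewrite ge0_integral_gauss; last 2 first.
- apply/measurable_EFinP; apply: measurableT_comp => //.
  by apply: measurable_funB => //; exact: measurable_funM.
- by move=> x; rewrite lee_fin expR_ge0.
rewrite -(integral_normal_pdf a 1); apply: eq_integral => x _.
rewrite -EFinM normal_pdf01 normal_pdfE ?oner_eq0// /normal_fun expr1n.
rewrite mulrCA -expRD; congr (_ * expR _)%:E.
by field.
Qed.


(** Domination: [|x| <= 4 + x^2 <= 4 e^(x^2/4)]. *)
Lemma integrable_gauss_id : gauss.-integrable setT (EFin \o @id R).
Proof.
apply: (le_integrable measurableT
  (g := fun x : R => (4 * expR (x ^+ 2 / 4))%:E)) => //.
- exact/measurable_EFinP.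
- move=> x _; rewrite !abse_EFin lee_fin [leRHS]ger0_norm ?mulr_ge0 ?expR_ge0//.
  apply: (@le_trans _ _ (4 * (1 + x ^+ 2 / 4))); last first.
    by rewrite ler_pM2l ?expR_ge1Dx.
  by rewrite ler_norml; apply/andP; split; nra.
- apply/integrableP; split.
    apply/measurable_EFinP; apply: measurable_funM => //.
    apply: measurableT_comp => //.
    by apply: measurable_funM => //; exact: measurable_funX.
  under eq_integral do rewrite gee0_abs ?lee_fin ?mulr_ge0 ?expR_ge0// EFinM.
  rewrite ge0_integralZl//; last first.
    apply/measurable_EFinP; apply: measurableT_comp => //.
    by apply: measurable_funM => //; exact: measurable_funX.
  by rewrite lte_mul_pinfty// (le_lt_trans expR_sqr_gauss)// ltry.
Qed.

(* Integrating [e^(ax - a^2/2) >= 1 + ax - a^2/2] gives [a E x <= a^2/2] for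
   every [a]. *)
Lemma mean_gauss : (\int[gauss]_x (x : R)%:E = 0)%E.
Proof.
have fin : (\int[gauss]_x (x : R)%:E)%E \is a fin_num.
  exact: (integrable_fin_num measurableT integrable_gauss_id).
rewrite -(fineK fin); congr EFin.
set m := fine _.
have int_lin a : gauss.-integrable setT
    (EFin \o (fun x : R => 1 + a * x - a ^+ 2 / 2)).
  rewrite (_ : _ \o _ = fun x => ((1 - a ^+ 2 / 2)%:E + a%:E * x%:E)%E).
    apply: integrableD => //; last first.
      exact: (integrableZl measurableT a integrable_gauss_id).
    exact: bounded_measurable_integrable (bounded_measurable_cst _).
  by apply/funext => x; rewrite /= -EFinM -EFinD; congr EFin; ring.
have key a : a * m <= a ^+ 2 / 2.
  have : (\int[gauss]_x (1 + a * x - a ^+ 2 / 2)%:E <= 1)%E.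
    rewrite -(exp_moment_gauss a); apply: le_integral => //.
    - exact: int_lin.
    - apply/integrableP; split.
        apply/measurable_EFinP; apply: measurableT_comp => //.
        by apply: measurable_funB => //; exact: measurable_funM.
      under eq_integral do rewrite gee0_abs ?lee_fin ?expR_ge0//.
      by rewrite exp_moment_gauss ltry.
    - by move=> x _; rewrite lee_fin -addrA expR_ge1Dx.
  rewrite (_ : (fun x : R => _) =
      fun x => ((1 - a ^+ 2 / 2)%:E + a%:E * x%:E)%E); last first.
    by apply/funext => x; rewrite -EFinM -EFinD; congr EFin; ring.
  rewrite integralD//; last 2 first.
  - exact: bounded_measurable_integrable (bounded_measurable_cst _).
  - exact: (integrableZl measurableT a integrable_gauss_id).
  rewrite integralZl//; last exact: integrable_gauss_id.
  rewrite -(EFin_Rintegral_prob gauss (bounded_measurable_cst _)).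
  rewrite Rintegral_prob_cst.
  by rewrite -(fineK fin) -/m -EFinM -EFinD lee_fin; lra.
(* The choice [a = m] gives [m^2 <= m^2/2]. *)
have m0 : m * m <= 0 by have := key m; lra.
by apply/eqP; rewrite -sqrf_eq0 eq_le sqr_ge0 expr2 m0.
Qed.

(** This is the Gibbs variational inequality; [a^2/2] is the relative entropy of N(0,1) with respect
    to N(a,1). *)
Lemma gauss_shift (h : R -> R) (a : R) : bounded_measurable h ->
  expR (\int[gauss]_x h x - a ^+ 2 / 2) <= \int[gauss]_x expR (h (x + a)).
Proof.
move=> bh; have mh := bh.1.
have madd (b : R) : measurable_fun setT (fun x : R => x + b).
  by apply: measurable_funD => //; exact: measurable_cst.
have bsh : bounded_measurable (fun x : R => expR (h (x + a))).
  by apply: bounded_measurable_expR; exact: bounded_measurable_comp (madd a) bh.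
pose L x := expR (h x + (a * x - a ^+ 2 / 2)).
have mL : measurable_fun setT L.
  apply: measurableT_comp => //; apply: measurable_funD => //.
  by apply: measurable_funB => //; exact: measurable_funM.
have L0 x : (0 <= (L x)%:E)%E by rewrite lee_fin expR_ge0.
(* Cameron-Martin: the shifted Gaussian has density [e^(ax - a^2/2)]. *)
have shiftE : (\int[gauss]_x (L x)%:E)%E = (\int[gauss]_x expR (h (x + a)))%:E.
  rewrite EFin_Rintegral_prob// ge0_integral_gauss//; last exact/measurable_EFinP.
  rewrite ge0_integral_gauss//; last by apply/measurable_EFinP; case: bsh.
  rewrite -(ge0_integral_lebesgue_shift a); last 2 first.
  - apply: emeasurable_funM; apply/measurable_EFinP => //.
    exact: measurable_normal_pdf.
  - by move=> x; rewrite mule_ge0// lee_fin normal_pdf_ge0.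
  apply: eq_integral => x _; rewrite -!EFinM !normal_pdf01; congr EFin.
  rewrite mulrCA [RHS]mulrCA -!expRD; congr (_ * expR _).
  by field.
(* Jensen in tangent form: the exponential lies above its tangent at [m], the mean of the exponent
   of [L], and that tangent integrates to [expR m] because the Gaussian is centred. *)
pose m := \int[gauss]_x h x - a ^+ 2 / 2.
have intL : gauss.-integrable setT (EFin \o L).
  apply/integrableP; split; first exact/measurable_EFinP.
  under eq_integral do rewrite gee0_abs ?L0//.
  by rewrite shiftE ltry.
have intax := integrableZl measurableT a integrable_gauss_id.
have inth : gauss.-integrable setT
    (EFin \o (fun x => h x + (1 - a ^+ 2 / 2 - m))).
  apply: bounded_measurable_integrable; apply: bounded_measurableD => //.
  exact: bounded_measurable_cst.
rewrite -lee_fin -shiftE -/m.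
apply: (@le_trans _ _ (\int[gauss]_x ((expR m)%:E *
    ((h x + (1 - a ^+ 2 / 2 - m))%:E + a%:E * x%:E)))%E); last first.
  apply: le_integral => //.
    by apply: integrableZl => //; exact: integrableD.
  move=> x _; rewrite -(EFinM a x) -EFinD -EFinM lee_fin.
  rewrite (_ : L x = expR m * expR (h x + (a * x - a ^+ 2 / 2) - m)).
    rewrite ler_pM2l ?expR_gt0//; apply: le_trans (expR_ge1Dx _).
    by rewrite le_eqVlt; apply/orP; left; apply/eqP; ring.
  by rewrite /L -expRD; congr expR; ring.
rewrite integralZl//; last exact: integrableD.
rewrite integralD// integralZl//; last exact: integrable_gauss_id.
rewrite mean_gauss mule0 adde0.
have bc c := @bounded_measurable_cst R _ R c.
rewrite -EFin_Rintegral_prob; last exact: bounded_measurableD.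
rewrite RintegralD_prob// Rintegral_prob_cst -EFinM lee_fin.
by rewrite le_eqVlt; apply/orP; left; apply/eqP; rewrite /m; ring.
Qed.

End Gauss.

Definition tadd {R : realType} {d} (x y : d.-tuple R) : d.-tuple R :=
  [tuple tnth x i + tnth y i | i < d].

Lemma measurable_tadd {R : realType} {d} (a : d.-tuple R) :
  measurable_fun setT (fun x => tadd x a).
Proof.
apply/measurable_fun_tnthP => i.
rewrite (_ : _ \o _ = fun x => tnth x i + tnth a i).
  apply: measurable_funD; [exact: measurable_tnth|exact: measurable_cst].
by apply/funext => x /=; rewrite tnth_mktuple.
Qed.

(** Tensorization of [gauss_shift]: the squared shifts of the coordinates add up to [inner a a]. *)
Lemma iid_gauss_shift {R : realType} {d} (h : d.-tuple R -> R) (a : d.-tuple R) :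
  bounded_measurable h ->
  expR (\int[iid gauss d]_z h z - inner a a / 2)
  <= \int[iid gauss d]_z expR (h (tadd z a)).
Proof.
elim: d h a => [|d IH] h a bh.
  rewrite !Rintegral_iid0 /inner big_ord0 mul0r subr0.
  by rewrite (tuple0 (tadd _ _)).
have bhs : bounded_measurable
    (fun z : R * d.-tuple R => h [tuple of z.1 :: z.2]).
  by apply: bounded_measurable_comp bh; exact: measurable_cons.
have bsh : bounded_measurable (fun z => expR (h (tadd z a))).
  apply: bounded_measurable_expR; apply: bounded_measurable_comp bh.
  exact: measurable_tadd.
have bG := bounded_measurable_Rintegral (iid gauss d) bhs.
pose a' : d.-tuple R := [tuple of behead a].
have aE : a = [tuple of thead a :: a'] by rewrite [LHS]tuple_eta.
have innerE : inner a a = thead a ^+ 2 + inner a' a'.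
  rewrite {1 2}aE /inner big_ord_recl/= !tnth0 -expr2; congr (_ + _).
  by apply: eq_bigr => i _; rewrite !tnthS.
rewrite !Rintegral_iidS//=.
(* In this middle term only the first coordinate is shifted: [gauss_shift], applied to the integral
   over the tail, bounds it from below, and the induction hypothesis then shifts the tail. *)
apply: (@le_trans _ _ (\int[gauss]_x expR (\int[iid gauss d]_xs
    h [tuple of x + thead a :: xs] - inner a' a' / 2))).
  have bc := @bounded_measurable_cst R _ R (- (inner a' a' / 2)).
  apply: le_trans (gauss_shift (thead a) (bounded_measurableD bG bc)).
  rewrite (RintegralD_prob gauss bG bc) Rintegral_prob_cst ler_expR innerE.
  by rewrite le_eqVlt; apply/orP; left; apply/eqP; field.
have taddE (x : R) (xs : d.-tuple R) :
    tadd [tuple of x :: xs] a =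
    [tuple of x + thead a :: tadd xs a'].
  apply: eq_from_tnth => i; rewrite tnth_mktuple.
  case: (unliftP ord0 i) => [j ->|->]; last by rewrite !tnth0 {1}aE tnth0.
  by rewrite {1}aE !tnthS tnth_mktuple.
have mx x : measurable_fun setT (fun xs : d.-tuple R => [tuple of x :: xs]).
  by apply: measurable_cons => //; exact: measurable_cst.
apply: le_Rintegral_prob.
- apply: bounded_measurable_expR; apply: bounded_measurableD; last first.
    exact: bounded_measurable_cst.
  apply: (bounded_measurable_comp _ bG).
  by apply: measurable_funD => //; exact: measurable_cst.
- apply: (bounded_measurable_Rintegral (iid gauss d)
    (f := fun z => expR (h (tadd [tuple of z.1 :: z.2] a)))).
  by apply: bounded_measurable_comp bsh; exact: measurable_cons.
- move=> x; under [leRHS]eq_Rintegral do rewrite taddE.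
  apply: (IH (fun xs => h [tuple of x + thead a :: xs])).
  by apply: bounded_measurable_comp bh.
Qed.

Lemma ge0_integral_iid_tnth {R : realType} {d0} {T : measurableType d0}
    (P : probability T R) (d : nat) (i : 'I_d) (f : T -> \bar R) :
  measurable_fun setT f -> (forall x, 0 <= f x)%E ->
  (\int[iid P d]_z f (tnth z i) = \int[P]_x f x)%E.
Proof.
move=> mf f0; elim: d i => [[]//|d IH] i.
have mfi n (j : 'I_n) : measurable_fun setT (fun z : n.-tuple T => f (tnth z j)).
  by apply: measurableT_comp => //; exact: measurable_tnth.
transitivity (\int[P \x iid P d]_z f (tnth (tcons z) i))%E.
  by apply: ge0_integral_distribution => //; exact: mfi.
rewrite (@fubini_tonelli1 _ _ T _ R P (iid P d)
  (fun z : T * d.-tuple T => f (tnth (tcons z) i)))//; last first.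
  by apply: (measurableT_comp (mfi _ i)); exact: measurable_tcons.
have cstE d1 (S : measurableType d1) (Q : probability S R) (c : \bar R) :
    (\int[Q]_x c = c)%E.
  by rewrite integral_cst// [X in (_ * X)%E](probability_setT Q) mule1.
rewrite /fubini_F/=; case: (unliftP ord0 i) => [j ->|->].
  under eq_integral do under eq_integral do rewrite tnthS.
  by under eq_integral do rewrite IH; exact: cstE.
under eq_integral do under eq_integral do rewrite tnth0.
by apply: eq_integral => x _ /=; exact: cstE.
Qed.

(** Reduces to the nonnegative case through positive and negative parts. *)
Lemma integral_iid_tnth {R : realType} {d0} {T : measurableType d0}
    (P : probability T R) (d : nat) (i : 'I_d) (f : T -> R) :
  P.-integrable setT (EFin \o f) ->
  (iid P d).-integrable setT (fun z => (f (tnth z i))%:E) /\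
  (\int[iid P d]_z (f (tnth z i))%:E = \int[P]_x (f x)%:E)%E.
Proof.
move=> intf; have mf := measurable_int P intf.
have mfi : measurable_fun setT (fun z : d.-tuple T => (f (tnth z i))%:E).
  by apply: (measurableT_comp mf); exact: measurable_tnth.
split.
  apply/integrableP; split => //.
  rewrite (ge0_integral_iid_tnth P i (f := fun x => `|(f x)%:E|%E))//.
    by case/integrableP : intf.
  exact: measurableT_comp.
rewrite integralE [RHS]integralE.
rewrite -(ge0_integral_iid_tnth P i (f := (EFin \o f)^\+%E))//; last first.
  exact: measurable_funepos.
rewrite -(ge0_integral_iid_tnth P i (f := (EFin \o f)^\-%E))//; last first.
  exact: measurable_funeneg.
by congr (_ - _)%E; apply: eq_integral => z _; rewrite ?funeposE ?funenegE.
Qed.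

(** * Projections onto the span of two vectors *)

Section InnerProduct.
Context {R : realType} {m : nat}.
Implicit Types x y z : m.-tuple R.

Definition lincomb (a : R) x (b : R) y : m.-tuple R :=
  [tuple a * tnth x i + b * tnth y i | i < m].

Definition axis (c : R) (j : 'I_m) : m.-tuple R :=
  [tuple if i == j then c else 0 | i < m].

Lemma inner_sym x y : inner x y = inner y x.
Proof. by apply: eq_bigr => i _; rewrite mulrC. Qed.

Lemma inner_lincomb z a x b y :
  inner z (lincomb a x b y) = a * inner z x + b * inner z y.
Proof.
rewrite /inner !mulr_sumr -big_split/=; apply: eq_bigr => i _.
by rewrite tnth_mktuple; ring.
Qed.

Lemma inner_axis x c j : inner x (axis c j) = c * tnth x j.
Proof.
rewrite /inner (bigD1 j)//= tnth_mktuple eqxx big1 ?addr0 1?mulrC// => i ij.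
by rewrite tnth_mktuple (negPf ij) mulr0.
Qed.

Lemma inner_ge0 x : 0 <= inner x x.
Proof. by apply: sumr_ge0 => i _; rewrite -expr2 sqr_ge0. Qed.

Lemma inner_eq0 x : inner x x = 0 -> forall i, tnth x i = 0.
Proof.
move=> x0 i; apply/eqP; rewrite -sqrf_eq0 expr2.
apply/eqP; apply: (psumr_eq0P _ x0) => // k _.
by rewrite -expr2 sqr_ge0.
Qed.

(* With the convention [x / 0 = 0], the quotients below vanish on null vectors,
   so no rank distinction is needed. *)
Lemma inner_divK x y : inner x y / inner x x * inner x x = inner x y.
Proof.
have [x0|x0] := eqVneq (inner x x) 0; last by rewrite divfK.
by rewrite x0 mulr0 /inner big1// => i _; rewrite inner_eq0// mul0r.
Qed.

(** The Gram-Schmidt residual of [y] along [x]; it is [y] itself when [x] is null. *)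
Definition orth x y := lincomb 1 y (- (inner x y / inner x x)) x.

Lemma inner_orth x y : inner x (orth x y) = 0.
Proof. by rewrite inner_lincomb mulNr inner_divK mul1r subrr. Qed.

(** Squared norm of the projection of the j-th basis vector on the line of [x]. *)
Definition coord_share x j : R := tnth x j ^+ 2 / inner x x.

(* Squared norm of the projection of the j-th basis vector on span(x, y). *)
Definition leverage (x y : m.-tuple R) j : R :=
  coord_share x j + coord_share (orth x y) j.

Lemma coord_share_ge0 x j : 0 <= coord_share x j.
Proof. by rewrite divr_ge0 ?sqr_ge0 ?inner_ge0. Qed.

Lemma sum_coord_share x : \sum_(j < m) coord_share x j <= 1.
Proof.
rewrite -mulr_suml [X in X / _](_ : _ = inner x x); last first.
  by apply: eq_bigr => i _; rewrite expr2.
by have [->|x0] := eqVneq (inner x x) 0; [rewrite mul0r|rewrite divff].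
Qed.

(** The sum is the trace of a projection of rank at most two. *)
Lemma sum_leverage x y : \sum_(j < m) leverage x y j <= 2.
Proof. by rewrite big_split/= -[2]/(1 + 1) lerD// sum_coord_share. Qed.

Lemma leverage_ge0 x y j : 0 <= leverage x y j.
Proof. by rewrite addr_ge0 ?coord_share_ge0. Qed.

Lemma leverage_le2 x y j : leverage x y j <= 2.
Proof.
apply: le_trans (sum_leverage x y); rewrite (bigD1 j)//= lerDl.
by apply: sumr_ge0 => i _; exact: leverage_ge0.
Qed.

Lemma exists_projection x y c j : exists w,
  [/\ inner x w = c * tnth x j, inner y w = c * tnth y j &
      inner w w = c ^+ 2 * leverage x y j].
Proof.
pose u := orth x y.
pose e := axis c j.
(* The projection of [e] on the span of [x] and [y], expanded along the orthogonal pair [x], [u]. *)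
pose w := lincomb (inner x e / inner x x) x (inner u e / inner u u) u.
have xw : inner x w = inner x e.
  by rewrite inner_lincomb inner_divK inner_orth mulr0 addr0.
have uw : inner u w = inner u e.
  by rewrite inner_lincomb inner_divK (inner_sym u x) inner_orth mulr0 add0r.
exists w; split; first by rewrite xw inner_axis.
  (* [y] is [u] plus a multiple of [x], so agreement on [x] and [u] passes to [y]. *)
  have yE z : inner y z = inner u z + inner x y / inner x x * inner x z.
    rewrite [inner u z]inner_sym inner_lincomb !(inner_sym z); ring.
  by rewrite yE xw uw -yE inner_axis.
rewrite {2}/w inner_lincomb !(inner_sym w) xw uw !inner_axis.
by rewrite /leverage /coord_share -/u; ring.
Qed.

End InnerProduct.

Lemma measurable_inner {R : realType} {m} {d} {S : measurableType d}
    (f g : S -> m.-tuple R) :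
  measurable_fun setT f -> measurable_fun setT g ->
  measurable_fun setT (fun s => inner (f s) (g s)).
Proof.
move=> mf mg; apply: measurable_sum => i; apply: measurable_funM.
- exact: (measurableT_comp (measurable_tnth i) mf).
- exact: (measurableT_comp (measurable_tnth i) mg).
Qed.

(** On nonnegative reals, 0 included, inversion agrees with the power -1, whose measurability is
    known. *)
Lemma measurable_invr_ge0 {R : realType} {d} {S : measurableType d} (f : S -> R) :
  (forall s, 0 <= f s) -> measurable_fun setT f ->
  measurable_fun setT (fun s => (f s)^-1).
Proof.
move=> f0 mf; under eq_fun do rewrite -powR_inv1//.
exact: (measurableT_comp (measurable_powR (-1)) mf).
Qed.

Section MeasurableLeverage.
Context {R : realType} {m : nat} {d} {S : measurableType d}.
Variables f g : S -> m.-tuple R.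
Hypotheses (mf : measurable_fun setT f) (mg : measurable_fun setT g).

Let measurable_inv_inner (h : S -> m.-tuple R) : measurable_fun setT h ->
  measurable_fun setT (fun s => (inner (h s) (h s))^-1).
Proof.
move=> mh; apply: measurable_invr_ge0; first by move=> s; exact: inner_ge0.
exact: measurable_inner.
Qed.

Let measurable_coord_share (h : S -> m.-tuple R) j : measurable_fun setT h ->
  measurable_fun setT (fun s => coord_share (h s) j).
Proof.
move=> mh; apply: measurable_funM; last exact: measurable_inv_inner.
by apply: measurable_funX; exact: (measurableT_comp (measurable_tnth j) mh).
Qed.

Lemma measurable_leverage j :
  measurable_fun setT (fun s => leverage (f s) (g s) j).
Proof.
apply: measurable_funD; apply: measurable_coord_share => //.
apply/measurable_fun_tnthP => i.
rewrite (_ : _ \o _ = fun s => 1 * tnth (g s) i +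
    - (inner (f s) (g s) / inner (f s) (f s)) * tnth (f s) i).
  apply: measurable_funD; apply: measurable_funM.
  - exact: measurable_cst.
  - exact: (measurableT_comp (measurable_tnth i) mg).
  - apply: measurable_funN; apply: measurable_funM; first exact: measurable_inner.
    exact: measurable_inv_inner.
  - exact: (measurableT_comp (measurable_tnth i) mf).
by apply/funext => s /=; rewrite tnth_mktuple.
Qed.

End MeasurableLeverage.

(** * Gaussian samples with a shifted coordinate *)

Section Embedding.
Context {R : realType} {m d : nat}.

(** The default value of [nth] matters here: it pads with zeros the coordinates from [m] on. *)
Definition embed (x : m.-tuple R) : d.-tuple R := [tuple nth 0 x i | i < d].

Definition take_coords (theta : d.-tuple R) : m.-tuple R :=
  [tuple nth 0 theta i | i < m].

Lemma inner_embed (theta : d.-tuple R) (x : m.-tuple R) : (m <= d)%N ->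
  inner theta (embed x) = inner (take_coords theta) x.
Proof.
move=> md; rewrite /inner.
transitivity (\sum_(i < d) nth 0 theta i * nth 0 x i).
  by apply: eq_bigr => i _; rewrite tnth_mktuple (tnth_nth 0).
rewrite (eq_bigr (fun i : 'I_m => nth 0 theta i * nth 0 x i)); last first.
  by move=> i _; rewrite tnth_mktuple (tnth_nth 0).
rewrite (big_ord_widen_cond d predT (fun i => nth 0 theta i * nth 0 x i) md)/=.
rewrite [RHS]big_mkcond/=; apply: eq_bigr => i _.
by case: ltnP => // im; rewrite [nth 0 x i]nth_default ?mulr0// size_tuple.
Qed.

Lemma measurable_nth_tuple {d0} {T : measurableType d0} n (x0 : T) i :
  measurable_fun setT (fun x : n.-tuple T => nth x0 x i).
Proof.
have [ni|ni] := ltnP i n.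
  rewrite (_ : (fun _ => _) = fun x : n.-tuple T => tnth x (Ordinal ni)).
    exact: measurable_tnth.
  by apply/funext => x; rewrite (tnth_nth x0).
rewrite (_ : (fun _ => _) = fun x : n.-tuple T => x0).
  exact: measurable_cst.
by apply/funext => x; rewrite nth_default ?size_tuple.
Qed.

Lemma measurable_take_coords : measurable_fun setT take_coords.
Proof.
apply/measurable_fun_tnthP => i.
rewrite (_ : _ \o _ = fun x : d.-tuple R => nth 0 x i).
  exact: measurable_nth_tuple.
by apply/funext => x /=; rewrite tnth_mktuple.
Qed.

Definition sample (s : R) (mu z : m.-tuple R) : d.-tuple R :=
  embed [tuple s * tnth z i + tnth mu i | i < m].

Lemma measurable_sample s mu : measurable_fun setT (sample s mu).
Proof.
apply/measurable_fun_tnthP => i.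
have [im|im] := ltnP i m.
  rewrite (_ : _ \o _ =
      fun z => s * tnth z (Ordinal im) + tnth mu (Ordinal im)).
    apply: measurable_funD; last exact: measurable_cst.
    apply: measurable_funM; first exact: measurable_cst.
    exact: measurable_tnth.
  apply/funext => x /=.
  by rewrite tnth_mktuple -[i : nat]/(Ordinal im : nat) -tnth_nth tnth_mktuple.
rewrite (_ : _ \o _ = fun z => 0); first exact: measurable_cst.
by apply/funext => x /=; rewrite tnth_mktuple nth_default// size_tuple.
Qed.

HB.instance Definition _ s mu :=
  isMeasurableFun.Build _ _ _ _ (sample s mu) (measurable_sample s mu).

Definition sample_law (s : R) (mu : m.-tuple R) : probability (d.-tuple R) R :=
  distribution (iid gauss m) (sample s mu).

End Embedding.
Arguments sample_law {R m} d s mu.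

Section Measurement.
Context {R : realType} {d : nat}.
Notation vec := (d.-tuple R).

Definition measurement (q : vec * vec) (x : vec) : R * R :=
  (inner q.1 x, inner q.2 x).

Lemma measurable_measurement {d0} {S : measurableType d0} (q : S -> vec * vec)
    (x : S -> vec) : measurable_fun setT q -> measurable_fun setT x ->
  measurable_fun setT (fun s => measurement (q s) (x s)).
Proof.
move=> mq mx; apply/measurable_fun_pairP; split => /=.
- by apply: measurable_inner => //; exact: (measurableT_comp measurable_fst mq).
- by apply: measurable_inner => //; exact: (measurableT_comp measurable_snd mq).
Qed.

Context {m : nat} (md : (m <= d)%N).

Definition query_leverage (q : vec * vec) (j : 'I_m) : R :=
  leverage (take_coords q.1) (take_coords q.2) j.

Lemma bounded_measurable_query_leverage j :
  bounded_measurable (fun q => query_leverage q j).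
Proof.
split.
  apply: measurable_leverage; apply: (measurableT_comp measurable_take_coords).
    exact: measurable_fst.
  exact: measurable_snd.
by exists 2 => q; rewrite ger0_norm ?leverage_ge0 ?leverage_le2.
Qed.

(* A measurement only sees the component of the mean in the span of the two
   queries. *)
Lemma sample_law_change (s c : R) (j : 'I_m) (q : vec * vec) (g : R * R -> R) :
  0 < s -> bounded_measurable g ->
  expR (\int[sample_law d s (axis 0 j)]_x g (measurement q x)
        - c ^+ 2 / (2 * s ^+ 2) * query_leverage q j)
  <= \int[sample_law d s (axis c j)]_x expR (g (measurement q x)).
Proof.
move=> s0 bg.
have mmq : measurable_fun setT (measurement q).
  by apply: measurable_measurement => //; exact: measurable_cst.
have bgq : bounded_measurable (fun x => g (measurement q x)).
  exact: bounded_measurable_comp bg.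
pose h z := g (measurement q (sample s (axis 0 j) z)).
have bh : bounded_measurable h.
  apply: (bounded_measurable_comp (measurable_sample s (axis 0 j)) bgq).
have [w [w1 w2 ww]] :=
  exists_projection (take_coords q.1) (take_coords q.2) c j.
(* This is [w / s]: shifting the noise by it moves the sample by [w], which both queries read as the
   mean [axis c j]. *)
pose a := lincomb s^-1 w 0 w.
have aa : inner a a = c ^+ 2 / s ^+ 2 * query_leverage q j.
  rewrite inner_lincomb inner_sym inner_lincomb ww /query_leverage.
  by field; rewrite gt_eqF.
rewrite !Rintegral_distribution//; last exact: bounded_measurable_expR.
have := iid_gauss_shift a bh; rewrite aa => H.
have -> : c ^+ 2 / (2 * s ^+ 2) * query_leverage q j =
    c ^+ 2 / s ^+ 2 * query_leverage q j / 2.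
  by field; rewrite gt_eqF.
apply: (le_trans H); rewrite le_eqVlt; apply/orP; left; apply/eqP.
apply: eq_Rintegral => z _; congr (expR (g _)).
have sampleE (theta : vec) mu : inner theta (sample s mu z) =
    s * inner (take_coords theta) z + inner (take_coords theta) mu.
  rewrite inner_embed// -[inner _ mu]mul1r -inner_lincomb.
  by congr inner; apply: eq_from_tnth => i; rewrite !tnth_mktuple mul1r.
have sampleE' (theta : vec) : inner theta (sample s (axis 0 j) (tadd z a)) =
    s * inner (take_coords theta) z + inner (take_coords theta) w.
  rewrite inner_embed// -[inner _ w]mul1r -inner_lincomb.
  congr inner; apply: eq_from_tnth => i; rewrite !tnth_mktuple.
  by case: ifP => _; field; rewrite gt_eqF.
by rewrite /measurement !sampleE' /= !sampleE w1 w2 !inner_axis.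
Qed.

End Measurement.

Lemma measurable_norm_infty {R : realType} {d} :
  measurable_fun setT (@norm_infty R d).
Proof.
rewrite /norm_infty; elim: (index_enum _) => [|i r IH].
  by under eq_fun do rewrite big_nil; exact: measurable_cst.
under eq_fun do rewrite big_cons.
apply: measurable_maxr => //; apply: measurableT_comp => //.
exact: measurable_tnth.
Qed.

Lemma norm_infty_sqr_le {R : realType} {d} (x : d.-tuple R) (B : R) :
  0 <= B -> (forall i, tnth x i ^+ 2 <= B) -> norm_infty x ^+ 2 <= B.
Proof.
move=> B0 xB; rewrite -[leRHS](sqr_sqrtr B0) ler_pXn2r ?nnegrE ?sqrtr_ge0//.
  rewrite /norm_infty; apply: bigmax_le; first exact: sqrtr_ge0.
  by move=> i _; rewrite -sqrtr_sqr ler_wsqrtr.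
by rewrite /norm_infty; apply: bigmax_ge_id.
Qed.

(** * Mean and moment constraint of the sample laws *)

Section SampleMoments.
Context {R : realType} {m d : nat} (md : (m <= d)%N) (m0 : (0 < m)%N).
Variables (s c : R) (j : 'I_m).

Lemma objective_sample_law (theta : d.-tuple R) :
  objective inner (sample_law d s (axis c j)) theta
  = (c * tnth (take_coords theta) j)%:E.
Proof.
rewrite /objective unlock.
have sampleE z : (inner theta (sample s (axis c j) z))%:E =
    ((\sum_(i < m) (s * tnth (take_coords theta) i)%:E * (tnth z i)%:E) +
      (c * tnth (take_coords theta) j)%:E)%E.
  rewrite inner_embed//.
  under eq_bigr do rewrite -EFinM.
  rewrite sumEFin -EFinD -inner_axis /inner -big_split/=; congr EFin.
  by apply: eq_bigr => i _; rewrite !tnth_mktuple; ring.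
have [intz Ez] := all_and2 (fun i : 'I_m =>
  integral_iid_tnth (f := id) i (@integrable_gauss_id R)).
have intZ i : (iid gauss m).-integrable setT
    (fun z : m.-tuple R => (s * tnth (take_coords theta) i)%:E * (tnth z i)%:E)%E.
  by apply: (integrableZl measurableT); exact: intz.
have intS : (iid gauss m).-integrable setT (fun z : m.-tuple R =>
    \sum_(i < m) (s * tnth (take_coords theta) i)%:E * (tnth z i)%:E)%E.
  by apply: integrable_sum.
have bc := @bounded_measurable_cst R _ (m.-tuple R)
  (c * tnth (take_coords theta) j).
rewrite integral_distribution; last 2 first.
- apply/measurable_EFinP.
  apply: (measurable_inner (f := fun=> theta) (g := id)) => //.
- rewrite (_ : _ \o _ = fun z => ((\sum_(i < m)
    (s * tnth (take_coords theta) i)%:E * (tnth z i)%:E) +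
      (c * tnth (take_coords theta) j)%:E)%E); last by apply/funext => z /=.
  apply: integrableD => //.
  exact: (bounded_measurable_integrable (iid gauss m) bc).
under eq_integral do rewrite /= sampleE.
rewrite integralD//; last exact: (bounded_measurable_integrable _ bc).
rewrite integral_sum// big1 ?add0e.
  by rewrite -(EFin_Rintegral_prob (iid gauss m) bc) Rintegral_prob_cst.
move=> i _; rewrite integralZl//.
by rewrite Ez mean_gauss mule0.
Qed.

(* [y/4 <= ln A - 1 + e^(y/4)/A], summed over the coordinates, bounds the
   expected maximum of the squares by [4 ln A]. *)
Lemma sample_sqr_le (z : m.-tuple R) (i : 'I_d) (A : R) : 1 <= ln A -> 0 < A ->
  tnth (sample s (axis c j) z) i ^+ 2 <=
  2 * c ^+ 2 + 8 * s ^+ 2 * (ln A - 1) +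
  8 * s ^+ 2 / A * \sum_(l < m) expR (tnth z l ^+ 2 / 4).
Proof.
move=> lnA A0; rewrite tnth_mktuple.
have sq0 : 0 <= 8 * s ^+ 2 by rewrite mulr_ge0 ?sqr_ge0.
have S0 : 0 <= \sum_(l < m) expR (tnth z l ^+ 2 / 4).
  by apply: sumr_ge0 => l _; exact: expR_ge0.
have c0 : 0 <= 2 * c ^+ 2 by rewrite mulr_ge0 ?sqr_ge0.
have [im|im] := ltnP i m; last first.
  rewrite nth_default ?size_tuple// expr0n/=.
  apply: addr_ge0; last by rewrite mulr_ge0// mulr_ge0// invr_ge0 ltW.
  by rewrite addr_ge0// mulr_ge0// subr_ge0.
rewrite -[i : nat]/(Ordinal im : nat) -tnth_nth tnth_mktuple tnth_mktuple.
set l := Ordinal im.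
have zS : expR (tnth z l ^+ 2 / 4) <= \sum_(l < m) expR (tnth z l ^+ 2 / 4).
  rewrite (bigD1 l)//= lerDl.
  by apply: sumr_ge0 => k _; exact: expR_ge0.
have : 1 + (tnth z l ^+ 2 / 4 - ln A) <= expR (tnth z l ^+ 2 / 4) / A.
  apply: le_trans (expR_ge1Dx _) _.
  by rewrite expRD expRN lnK.
set y := tnth z l => key.
set e := if l == j then c else 0.
have eC : e ^+ 2 <= c ^+ 2.
  by rewrite /e; case: ifP => // _; rewrite expr0n/= sqr_ge0.
have yS : y ^+ 2 <= 4 * (ln A - 1) +
    4 / A * \sum_(l < m) expR (tnth z l ^+ 2 / 4).
  have : expR (y ^+ 2 / 4) / A <= (\sum_(l < m) expR (tnth z l ^+ 2 / 4)) / A.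
    by rewrite ler_pM2r ?invr_gt0.
  by move: key; lra.
(* From [(sy + e)^2 <= 2 s^2 y^2 + 2 e^2]. *)
apply: (@le_trans _ _ (2 * c ^+ 2 + 2 * s ^+ 2 * y ^+ 2)).
  have := sqr_ge0 (s * y - e); move: eC; rewrite sqrrB sqrrD exprMn; lra.
rewrite -addrA lerD2l.
have -> : forall a b : R, 8 * s ^+ 2 * a + 8 * s ^+ 2 / A * b =
    2 * s ^+ 2 * (4 * a + 4 / A * b) by move=> a b; field; rewrite gt_eqF.
by rewrite ler_wpM2l// mulr_ge0 ?sqr_ge0.
Qed.

Lemma norm_infty_sample_law : 1 <= ln (3 * m%:R : R) ->
  ('E_(sample_law d s (axis c j))[(fun x => norm_infty x ^+ 2)%R] <=
   (2 * c ^+ 2 + 8 * s ^+ 2 * ln (3 * m%:R))%:E)%E.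
Proof.
move=> lnA; have A0 : 0 < 3 * m%:R :> R by rewrite mulr_gt0 ?ltr0n.
set A := 3 * m%:R in lnA A0 *.
have mE : measurable_fun setT (fun x : R => (expR (x ^+ 2 / 4))%:E).
  apply/measurable_EFinP; apply: measurableT_comp => //.
  by apply: measurable_funM => //; exact: measurable_funX.
have mEi (i : 'I_m) : measurable_fun setT
    (fun z : m.-tuple R => (expR (tnth z i ^+ 2 / 4))%:E).
  by apply: (measurableT_comp mE); exact: measurable_tnth.
have sq0 : 0 <= 8 * s ^+ 2 by rewrite mulr_ge0 ?sqr_ge0.
have sA0 : 0 <= 8 * s ^+ 2 / A by rewrite mulr_ge0// invr_ge0 ltW.
have C0 : 0 <= 2 * c ^+ 2 + 8 * s ^+ 2 * (ln A - 1).
  by rewrite addr_ge0// mulr_ge0 ?sqr_ge0// subr_ge0.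
have mN : measurable_fun setT (fun x : d.-tuple R => (norm_infty x ^+ 2)%:E).
  by apply/measurable_EFinP/measurable_funX; exact: measurable_norm_infty.
rewrite unlock ge0_integral_distribution//; last first.
  by move=> x; rewrite lee_fin sqr_ge0.
have mS : measurable_fun setT (fun z : m.-tuple R =>
    \sum_(l < m) (expR (tnth z l ^+ 2 / 4))%:E)%E.
  by apply: emeasurable_sum.
apply: (@le_trans _ _ (\int[iid gauss m]_z
  ((2 * c ^+ 2 + 8 * s ^+ 2 * (ln A - 1))%:E + (8 * s ^+ 2 / A)%:E *
   \sum_(l < m) (expR (tnth z l ^+ 2 / 4))%:E))%E).
  apply: ge0_le_integral => //.
  - by move=> x _; rewrite lee_fin sqr_ge0.
  - by apply: (measurableT_comp mN); exact: measurable_sample.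
  - apply: emeasurable_funD; first exact: measurable_cst.
    by apply: emeasurable_funM => //; exact: measurable_cst.
  - move=> z _; rewrite sumEFin -EFinM -EFinD lee_fin.
    apply: norm_infty_sqr_le => [|i]; last exact: sample_sqr_le.
    by rewrite addr_ge0// mulr_ge0// sumr_ge0// => l _; exact: expR_ge0.
rewrite ge0_integralD//; last 2 first.
- by move=> z _; rewrite mule_ge0 ?lee_fin// sume_ge0// => l _.
- by apply: emeasurable_funM => //; exact: measurable_cst.
rewrite ge0_integralZl//; last first.
  by move=> z _; rewrite sume_ge0// => l _; rewrite lee_fin expR_ge0.
rewrite -(EFin_Rintegral_prob (iid gauss m) (bounded_measurable_cst _)).
rewrite Rintegral_prob_cst.
have sumE : (\int[iid gauss m]_z (\sum_(l < m) (expR ((tnth z l : R) ^+ 2 / 4))%:E)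
    <= (2 * m%:R)%:E)%E.
  rewrite ge0_integral_sum//.
  apply: (@le_trans _ _ (\sum_(l < m) 2%:E)%E).
    apply: lee_sum => l _; apply: le_trans expR_sqr_gauss.
    rewrite -(ge0_integral_iid_tnth gauss l
      (f := fun x : R => (expR (x ^+ 2 / 4))%:E))//.
  by rewrite sumEFin lee_fin sumr_const card_ord mulr_natr.
apply: (@le_trans _ _ ((2 * c ^+ 2 + 8 * s ^+ 2 * (ln A - 1))%:E +
    (8 * s ^+ 2 / A)%:E * (2 * m%:R)%:E)%E).
  by rewrite leeD2l// lee_wpmul2l.
rewrite -EFinM -EFinD lee_fin.
(* With [A = 3m] this term stays below the [8 s^2] saved by the [- 1] in [ln A - 1]. *)
have -> : 8 * s ^+ 2 / A * (2 * m%:R) = 16 / 3 * s ^+ 2.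
  by rewrite /A; field; rewrite pnatr_eq0 -lt0n m0.
have := sqr_ge0 s; lra.
Qed.

End SampleMoments.

(** * Adaptive queries *)

Section Interaction.
Context {R : realType} {d K : nat} {Theta : set (d.-tuple R)}.
Notation vec := (d.-tuple R).
Variable A : algorithm K Theta.

Lemma eq_observations (u : seed A) (x x' : nat -> vec) t :
  (forall i, (i < t)%N -> x i = x' i) ->
  observations inner u x t = observations inner u x' t.
Proof.
elim: t => [//|t IH] xx' /=; rewrite IH ?xx'// => i it.
by apply: xx'; exact: ltnW.
Qed.

Lemma observationsS (u : seed A) (x : nat -> vec) t :
  observations inner u x t.+1 =
  [tuple of rcons (observations inner u x t)
     (measurement (query A (u, observations inner u x t)) (x t))].
Proof. by []. Qed.

Lemma measurable_observations {d0} {S : measurableType d0} (us : S -> seed A)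
    (X : S -> nat -> vec) t :
  measurable_fun setT us -> (forall i, measurable_fun setT (X ^~ i)) ->
  measurable_fun setT (fun s => observations inner (us s) (X s) t).
Proof.
move=> mu mX; elim: t => [|t IH]; first exact: measurable_cst.
apply: measurable_rcons => //.
apply: measurable_measurement => //.
apply: (measurableT_comp (measurable_query A t)).
exact/measurable_fun_pairP.
Qed.

Variable u : seed A.

Lemma measurable_query_section t :
  measurable_fun setT (fun y : t.-tuple (R * R) => query A (u, y)).
Proof.
apply: (measurableT_comp (measurable_query A t)); exact: pair1_measurable.
Qed.

Lemma bounded_measurable_rcons t (psi : t.+1.-tuple (R * R) -> R) :
  bounded_measurable psi -> bounded_measurable
    (fun z : t.-tuple (R * R) * vec =>
      psi [tuple of rcons z.1 (measurement (query A (u, z.1)) z.2)]).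
Proof.
move=> bpsi; apply: bounded_measurable_comp bpsi.
apply: measurable_rcons => //; apply: measurable_measurement => //.
apply: (measurableT_comp (measurable_query A t)).
by apply/measurable_fun_pairP; split; [exact: measurable_cst|exact: measurable_fst].
Qed.

(* Expectation under the sample law P0 of [psi (observations)] minus the total
   cost of the queries, computed by backward induction. *)
Fixpoint net_value (P0 : probability vec R) (cost : vec * vec -> R) (t : nat) :
    (t.-tuple (R * R) -> R) -> R :=
  match t with
  | 0 => fun psi => psi [tuple]
  | t'.+1 => fun psi => net_value P0 cost (fun y =>
      \int[P0]_x psi [tuple of rcons y (measurement (query A (u, y)) x)]
      - cost (query A (u, y)))
  end.

Lemma bounded_measurable_net_step (P0 : probability vec R)
    (cost : vec * vec -> R) t (psi : t.+1.-tuple (R * R) -> R) :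
  bounded_measurable cost -> bounded_measurable psi ->
  bounded_measurable (fun y : t.-tuple (R * R) =>
      \int[P0]_x psi [tuple of rcons y (measurement (query A (u, y)) x)]
      - cost (query A (u, y))).
Proof.
move=> bcost bpsi; apply: bounded_measurableD.
  exact: (bounded_measurable_Rintegral P0 (bounded_measurable_rcons bpsi)).
under eq_fun do rewrite -mulN1r.
apply: bounded_measurableM; first exact: bounded_measurable_cst.
apply: (bounded_measurable_comp _ bcost); exact: measurable_query_section.
Qed.

(** Given the first [t] observations the next query is fixed, so [change] applies to the last
    measurement and leaves the exponential of one step of [net_value]; the induction hypothesis
    handles that step as a function of the earlier observations. *)
Lemma expR_net_value (P0 P : probability vec R) (cost : vec * vec -> R) (x0 : vec) :
  bounded_measurable cost ->
  (forall q (g : R * R -> R), bounded_measurable g ->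
    expR (\int[P0]_x g (measurement q x) - cost q)
    <= \int[P]_x expR (g (measurement q x))) ->
  forall t (psi : t.-tuple (R * R) -> R), bounded_measurable psi ->
  expR (net_value P0 cost psi)
  <= \int[iid P t]_xs expR (psi (observations inner u (nth x0 xs) t)).
Proof.
move=> bcost change; elim=> [|t IH] psi bpsi.
  by rewrite Rintegral_iid0.
have mobs n : measurable_fun setT
    (fun xs : n.-tuple vec => observations inner u (nth x0 xs) n).
  apply: measurable_observations => [|i]; first exact: measurable_cst.
  exact: measurable_nth_tuple.
have bstep := bounded_measurable_net_step P0 bcost bpsi.
have bobs : bounded_measurable (fun xs : t.+1.-tuple vec =>
    expR (psi (observations inner u (nth x0 xs) t.+1))).
  apply: bounded_measurable_expR; exact: bounded_measurable_comp (mobs _) bpsi.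
rewrite Rintegral_iid_rcons// [net_value _ _ _]/=.
apply: le_trans (IH _ bstep) _; apply: le_Rintegral_prob.
- by apply: bounded_measurable_expR; exact: bounded_measurable_comp (mobs _) bstep.
- apply: (bounded_measurable_Rintegral P
    (f := fun z : t.-tuple vec * vec => expR (psi (observations inner u
      (nth x0 [tuple of rcons z.1 z.2]) t.+1)))).
  by apply: bounded_measurable_comp bobs; exact: measurable_rcons.
- move=> xs; set y := observations inner u (nth x0 xs) t.
  have yE x : observations inner u (nth x0 [tuple of rcons xs x]) t.+1 =
      [tuple of rcons y (measurement (query A (u, y)) x)].
    rewrite observationsS /= nth_rcons size_tuple ltnn eqxx.
    rewrite (eq_observations _ (x' := nth x0 xs))// => i it.
    by rewrite nth_rcons size_tuple it.
  under [leRHS]eq_Rintegral do rewrite yE.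
  apply: (change _ (fun o => psi [tuple of rcons y o])).
  apply: bounded_measurable_comp bpsi; apply: measurable_rcons => //.
Qed.

(** All net values are computed under the same [P0], so they can be summed before integrating. The
    bound on the total cost holds for every query, hence also for adaptively chosen ones, and each
    round loses at most [c]. *)
Lemma sum_net_value (I : finType) (P0 : probability vec R)
    (cost : I -> vec * vec -> R) (c : R) :
  (forall i, bounded_measurable (cost i)) ->
  (forall q, \sum_i cost i q <= c) ->
  forall t (psi : I -> t.-tuple (R * R) -> R) (b : R),
  (forall i, bounded_measurable (psi i)) -> (forall y, b <= \sum_i psi i y) ->
  b - t%:R * c <= \sum_i net_value P0 (cost i) (psi i).
Proof.
move=> bcost costc; elim=> [|t IH] psi b bpsi psib /=.
  by rewrite mul0r subr0.
apply: (le_trans _ (IH (fun i (y : t.-tuple (R * R)) => \int[P0]_x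
    psi i [tuple of rcons y (measurement (query A (u, y)) x)]
    - cost i (query A (u, y))) (b - c) _ _)).
- by rewrite -natr1; lra.
- by move=> i; exact: bounded_measurable_net_step.
move=> y; rewrite big_split/= sumrN lerD ?lerN2//.
have brc i := bounded_measurable_section y (bounded_measurable_rcons (bpsi i)).
rewrite -Rintegral_sum_prob// -[leLHS](Rintegral_prob_cst P0).
apply: le_Rintegral_prob => //; first exact: bounded_measurable_cst.
exact: bounded_measurable_sum.
Qed.

End Interaction.

(** Squaring [e^(x/2) (1 - x/2) <= 1] reduces the claim to a polynomial inequality. *)
Lemma expR_le_quad {R : realType} (x : R) : `|x| <= 4^-1 ->
  expR x <= 1 + x + x ^+ 2.
Proof.
rewrite ler_norml => /andP[x1 x2].
have := expR_ge1Dx (- (x / 2)); rewrite expRN => H.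
have e0 := expR_gt0 (x / 2).
have xE : expR x = expR (x / 2) ^+ 2 by rewrite expr2 -expRD; congr expR; field.
have H1 : expR (x / 2) * (1 - x / 2) <= 1.
  by rewrite mulrC -ler_pdivlMr// mul1r.
have p0 : 0 < 1 - x / 2 by lra.
rewrite xE.
have H2 : expR (x / 2) ^+ 2 * (1 - x / 2) ^+ 2 <= 1.
  rewrite -exprMn -[leRHS](expr1n _ 2) ler_pXn2r ?nnegrE//.
  by rewrite mulr_ge0 ?ltW.
(* The difference of the two sides is [x^2 (1 - 3x + x^2) / 4]. *)
have H3 : 1 <= (1 + x + x ^+ 2) * (1 - x / 2) ^+ 2.
  have : 0 <= x ^+ 2 * (1 - 3 * x + x ^+ 2).
    by rewrite mulr_ge0 ?sqr_ge0//; have := sqr_ge0 x; lra.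
  by nra.
by rewrite -(ler_pM2r (exprn_gt0 2 p0)); exact: le_trans H2 H3.
Qed.

(** * The lower bound *)

Lemma ln_mul3_ge1 {R : realType} (n : nat) : (0 < n)%N -> 1 <= ln (3 * n%:R : R).
Proof.
move=> n0; have n1 : 1 <= n%:R :> R by rewrite ler1n.
rewrite -[leLHS](expRK (1 : R)) ler_ln ?posrE ?expR_gt0//; last by lra.
apply: (@le_trans _ _ 3); last by lra.
have -> : expR 1 = expR 4^-1 ^+ 4 :> R by rewrite -expRM_natl mulfV.
(* 21/16 is the quadratic bound at 1/4, and its fourth power is below 3. *)
have e4 : expR (4^-1 : R) <= 21 / 16.
  by apply: le_trans (expR_le_quad _) _; rewrite ?ger0_norm//; lra.
apply: le_trans (_ : (21 / 16) ^+ 4 <= _).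
  by rewrite ler_pXn2r ?nnegrE ?expR_ge0//; lra.
lra.
Qed.

Section LowerBound.
Context {R : realType} {d m k : nat} {r : R}.
Hypotheses (md : (m <= d)%N) (m0 : (0 < m)%N) (r0 : 0 < r).
Notation vec := (d.-tuple R).

Lemma take_coords_le_norm1 (theta : vec) (j : 'I_m) :
  `|tnth (take_coords theta) j| <= norm1 theta.
Proof.
rewrite tnth_mktuple -[j : nat]/(widen_ord md j : nat) -tnth_nth.
by rewrite /norm1 (bigD1 (widen_ord md j))//= lerDl sumr_ge0.
Qed.

Lemma take_coords_axis (c : R) (j : 'I_m) :
  tnth (take_coords (axis c (widen_ord md j))) j = c.
Proof.
rewrite tnth_mktuple -[j : nat]/(widen_ord md j : nat) -tnth_nth.
by rewrite tnth_mktuple eqxx.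
Qed.

Lemma norm1_axis (c : R) (j : 'I_d) : norm1 (axis c j) = `|c|.
Proof.
rewrite /norm1 (bigD1 j)//= tnth_mktuple eqxx big1 ?addr0// => i ij.
by rewrite tnth_mktuple (negPf ij) normr0.
Qed.

Lemma axis0 (j j' : 'I_m) : axis (0 : R) j = axis 0 j'.
Proof. by apply: eq_from_tnth => i; rewrite !tnth_mktuple !if_same. Qed.

Variables (A : algorithm k (l1_ball d r)) (s delta : R).
Hypotheses (s0 : 0 < s) (delta0 : 0 < delta).

Let sg (b : bool) : R := (-1) ^+ b.

Let law (i : bool * 'I_m) : probability vec R :=
  sample_law d s (axis (sg i.1 * delta) i.2).

Let sgE b : sg b * sg b = 1.
Proof. by rewrite -expr2 -exprM mulnC exprM sqrrN expr1n expr1n. Qed.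

Let norm_sg b : `|sg b| = 1.
Proof. by rewrite normrX normrN1 expr1n. Qed.

(** The index [(b, j)] stands for the vector [v = (-1)^b e_j]; dividing by [r] brings the statistic
    into [-1, 1] on the ball. *)
Definition correlation (i : bool * 'I_m) (theta : vec) : R :=
  (-1) ^+ i.1 * tnth (take_coords theta) i.2 / r.

Lemma correlation_output i z : `|correlation i (output A z)| <= 1.
Proof.
rewrite /correlation !normrM -/(sg i.1) norm_sg mul1r normfV (gtr0_norm r0).
rewrite ler_pdivrMr// mul1r.
by apply: le_trans (take_coords_le_norm1 _ _) _; exact: (output_in A z).
Qed.

Lemma measurable_correlation i : measurable_fun setT (correlation i).
Proof.
apply: measurable_funM; last exact: measurable_cst.
apply: measurable_funM; first exact: measurable_cst.
exact: (measurableT_comp (measurable_tnth i.2) measurable_take_coords).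
Qed.

Lemma bounded_measurable_correlation_output i :
  bounded_measurable (fun z => correlation i (output A z)).
Proof.
split; last by exists 1 => z; exact: correlation_output.
exact: (measurableT_comp (measurable_correlation i) (measurable_output A)).
Qed.

Lemma ereal_inf_objective_law i :
  ereal_inf (objective inner (law i) @` l1_ball d r) = (- (delta * r))%:E.
Proof.
apply/eqP; rewrite eq_le; apply/andP; split.
  apply: ereal_inf_lbound.
  (* The vertex of the l1 ball opposite to the mean. *)
  exists (axis (- (sg i.1 * r)) (widen_ord md i.2)).
    by rewrite /l1_ball/= norm1_axis normrN normrM norm_sg mul1r gtr0_norm.
  rewrite objective_sample_law// take_coords_axis; congr EFin.
  by rewrite mulrN mulrACA sgE mul1r.
apply: le_ereal_inf_tmp => _ [theta thr <-].
rewrite objective_sample_law// lee_fin.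
have : `|sg i.1 * delta * tnth (take_coords theta) i.2| <= delta * r.
  rewrite !normrM norm_sg mul1r gtr0_norm// ler_pM2l//.
  exact: le_trans (take_coords_le_norm1 _ _) thr.
by rewrite ler_norml => /andP[].
Qed.

Lemma bounded_measurable_correlation_estimate i :
  bounded_measurable (fun w : seed A * k.-tuple vec =>
    correlation i (estimate inner w)).
Proof.
apply: (bounded_measurable_comp _ (bounded_measurable_correlation_output i)).
apply/measurable_fun_pairP; split; first exact: measurable_fst.
apply: (measurable_observations (us := fst)
  (X := fun w : seed A * k.-tuple vec => nth [tuple of nseq d 0] w.2)) => // l.
exact: (measurableT_comp (measurable_nth_tuple _ l) measurable_snd).
Qed.

(** The objective is linear with minimum [- delta r] on the ball, so the gap is an affine function
    of the correlation, and a lower bound on correlations suffices. *)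
Lemma expected_gap_law i : expected_gap A inner (law i) =
  (delta * r * (1 + \int[(seed_law A \x iid (law i) k)%E]_w
     correlation i (estimate inner w)))%:E.
Proof.
have bc := bounded_measurable_correlation_estimate i.
rewrite /expected_gap ereal_inf_objective_law.
have gapE w : (objective inner (law i) (estimate inner w) -
    (- (delta * r))%:E)%E =
    (delta * r * (1 + correlation i (estimate inner w)))%:E.
  rewrite objective_sample_law// -EFinB; congr EFin.
  by rewrite /correlation /sg; field; rewrite gt_eqF.
under eq_integral do rewrite gapE.
have bc1 := bounded_measurableD (@bounded_measurable_cst R _ _ 1) bc.
rewrite -EFin_Rintegral_prob; last first.
  by apply: bounded_measurableM => //; exact: bounded_measurable_cst.
rewrite RintegralZ_prob// RintegralD_prob// ?Rintegral_prob_cst//.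
exact: bounded_measurable_cst.
Qed.

Hypothesis small_drift : 16 * k%:R * delta ^+ 2 <= m%:R * s ^+ 2.

(** Once the seed is fixed the algorithm is deterministic, which is the setting of [net_value]. *)
Lemma sum_correlation (u : seed A) :
  - m%:R <= \sum_i \int[iid (law i) k]_xs
    correlation i (estimate inner (u, xs)).
Proof.
pose x0 : vec := [tuple of nseq d 0].
pose j0 := Ordinal m0.
(* The centred reference law; [axis 0 j] is the null vector for every [j], so it serves all
   indices. *)
pose P0 : probability vec R := sample_law d s (axis 0 j0).
pose kappa := delta ^+ 2 / (2 * s ^+ 2).
pose cost (i : bool * 'I_m) (q : vec * vec) := kappa * query_leverage q i.2.
pose psi (i : bool * 'I_m) (y : k.-tuple (R * R)) :=
  4^-1 * correlation i (output A (u, y)).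
have kappa0 : 0 <= kappa by rewrite divr_ge0 ?sqr_ge0// mulr_ge0 ?sqr_ge0.
have bcost i : bounded_measurable (cost i).
  apply: bounded_measurableM; first exact: bounded_measurable_cst.
  exact: bounded_measurable_query_leverage.
have bpsi i : bounded_measurable (psi i).
  apply: bounded_measurableM; first exact: bounded_measurable_cst.
  exact: (bounded_measurable_section u (bounded_measurable_correlation_output i)).
have bobs i : bounded_measurable (fun xs : k.-tuple vec =>
    psi i (observations inner u (nth x0 xs) k)).
  apply: (bounded_measurable_comp _ (bpsi i)).
  apply: measurable_observations => [|l]; first exact: measurable_cst.
  exact: measurable_nth_tuple.
have sum_pair (F : bool * 'I_m -> R) :
    \sum_i F i = \sum_(j < m) F (true, j) + \sum_(j < m) F (false, j).
  rewrite (eq_bigr (fun p => F (p.1, p.2))); last by case.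
  by rewrite -(pair_bigA _ (fun b j => F (b, j)))/= big_bool.
(* The leverages sum to at most 2, and each coordinate occurs with both signs. *)
have costK q : \sum_i cost i q <= 4 * kappa.
  rewrite sum_pair /cost/= -!mulr_sumr.
  have := sum_leverage (m := m) (take_coords q.1) (take_coords q.2).
  move/(ler_wpM2l kappa0); rewrite /query_leverage; lra.
(* Opposite signs cancel, so the sum is 0. *)
have psi0 y : 0 <= \sum_i psi i y.
  rewrite sum_pair -big_split/= big1// => j _.
  by rewrite /psi /correlation/= expr1 expr0; ring.
have net := sum_net_value u P0 bcost costK bpsi psi0.
(* From [1 + net <= e^net <= E e^psi <= 1 + 1/16 + E psi]; the factor 1/4 in [psi] gives
   [psi^2 <= 1/16]. *)
have step i : net_value u P0 (cost i) (psi i) <= 16^-1 + 4^-1 *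
    \int[iid (law i) k]_xs correlation i (estimate inner (u, xs)).
  have H1 := expR_ge1Dx (net_value u P0 (cost i) (psi i)).
  have H2 : expR (net_value u P0 (cost i) (psi i)) <=
      \int[iid (law i) k]_xs expR (psi i (observations inner u (nth x0 xs) k)).
    apply: expR_net_value => // q g bg.
    have := sample_law_change md (sg i.1 * delta) i.2 q s0 bg.
    by rewrite (axis0 i.2 j0) exprMn expr2 sgE mul1r.
  have H3 : \int[iid (law i) k]_xs
      expR (psi i (observations inner u (nth x0 xs) k))
      <= \int[iid (law i) k]_xs ((1 + 16^-1) +
           psi i (observations inner u (nth x0 xs) k)).
    apply: le_Rintegral_prob.
    - exact: bounded_measurable_expR.
    - by apply: bounded_measurableD => //; exact: bounded_measurable_cst.
    - move=> xs; set p := psi _ _.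
      have p4 : `|p| <= 4^-1.
        rewrite normrM ger0_norm// ler_piMr//; exact: correlation_output.
      apply: le_trans (expR_le_quad p4) _.
      have : p ^+ 2 <= 4^-1 ^+ 2.
        by rewrite -real_normK ?num_real// ler_pXn2r ?nnegrE.
      by lra.
  have bc := @bounded_measurable_cst R _ (k.-tuple vec) (1 + 16^-1).
  move: H3; rewrite RintegralD_prob// Rintegral_prob_cst => H3.
  have H4 : \int[iid (law i) k]_xs psi i (observations inner u (nth x0 xs) k)
      = 4^-1 * \int[iid (law i) k]_xs correlation i (estimate inner (u, xs)).
    rewrite -RintegralZ_prob//.
    exact: (bounded_measurable_section u
      (bounded_measurable_correlation_estimate i)).
  by rewrite -H4; lra.
have := ler_sum (index_enum _) (fun i (_ : true) => step i).
rewrite big_split/= -mulr_sumr sumr_const card_prod card_bool card_ord.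
rewrite -[16^-1 *+ _]mulr_natr natrM => H.
(* [small_drift] caps the total cost of the k rounds. Together with [2m/16] from the quadratic terms
   the loss is [m/4], which becomes [m] after multiplication by 4. *)
have K8 : k%:R * (4 * kappa) <= m%:R / 8.
  have -> : k%:R * (4 * kappa) = 16 * k%:R * delta ^+ 2 / (8 * s ^+ 2).
    by rewrite /kappa; field; rewrite gt_eqF.
  rewrite ler_pdivrMr ?mulr_gt0 ?exprn_gt0//.
  by apply: le_trans small_drift _; lra.
by lra.
Qed.

Lemma exists_gap : exists i,
  ((delta * r / 2)%:E <= expected_gap A inner (law i))%E.
Proof.
pose C i := \int[(seed_law A \x iid (law i) k)%E]_w
  correlation i (estimate inner w).
have bc := bounded_measurable_correlation_estimate.
have sumC : - m%:R <= \sum_i C i.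
  (* Fubini averages the fixed-seed bound over the seed. *)
  have CE i : C i = \int[seed_law A]_u \int[iid (law i) k]_xs
      correlation i (estimate inner (u, xs)).
    exact: Rintegral_prod.
  under eq_bigr do rewrite CE.
  have bi i := bounded_measurable_Rintegral (iid (law i) k) (bc i).
  rewrite -Rintegral_sum_prob// -[leLHS](Rintegral_prob_cst (seed_law A)).
  apply: le_Rintegral_prob; first exact: bounded_measurable_cst.
    exact: bounded_measurable_sum.
  exact: sum_correlation.
(* Pigeonhole: there are 2m correlations and their sum is at least -m. *)
have [[i Ci]|noC] := pselect (exists i, - 2^-1 <= C i).
  exists i; rewrite expected_gap_law lee_fin -/(C i).
  have : 0 <= delta * r * (2^-1 + C i).
    by apply: mulr_ge0; [apply/ltW/mulr_gt0|lra].
  by lra.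
have Clt i : C i < - 2^-1.
  by rewrite ltNge; apply/negP => Ci; apply: noC; exists i.
have : \sum_i C i < \sum_(i : bool * 'I_m) - 2^-1.
  by apply: ltr_sum => //; apply/hasP; exists (true, Ordinal m0).
rewrite sumr_const card_prod card_bool card_ord -[_ *+ (2 * m)]mulr_natr natrM.
by lra.
Qed.

End LowerBound.

Theorem proposition2 (R : realType) (d k : nat) (G r : R)
    (hd : (1 <= d)%N) (hk : (1 <= k)%N) (hG : 0 < G) (hr : 0 < r) :
  ((1 / 24 * (G * r / Num.sqrt k%:R) *
      Num.min (Num.sqrt k%:R / Num.sqrt (ln (3 * k%:R)))
              (Num.sqrt d%:R / Num.sqrt (ln (3 * d%:R))))%:E
    <= minimax_error k (family_G_infty G) (l1_ball d r))%E.
Proof.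
pose m := minn k d.
have md : (m <= d)%N by exact: geq_minr.
have mk : (m <= k)%N by exact: geq_minl.
have m0 : (0 < m)%N by rewrite leq_min hk hd.
have L1 : 1 <= ln (3 * m%:R : R) by exact: ln_mul3_ge1.
set L := ln (3 * m%:R : R) in L1 *.
have L0 : 0 < L by lra.
have k0 : 0 < k%:R :> R by rewrite ltr0n.
have mR0 : 0 < m%:R :> R by rewrite ltr0n.
(* This makes [9 s^2 L = G^2]: the noise uses [8 s^2 L] of the moment budget and the mean uses the
   rest. *)
pose s := G / (3 * Num.sqrt L).
(* The largest [delta] allowed by the drift condition, which becomes an equality. *)
pose delta := s * Num.sqrt m%:R / (4 * Num.sqrt k%:R).
have s0 : 0 < s by rewrite divr_gt0// mulr_gt0// sqrtr_gt0.
have delta0 : 0 < delta.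
  by apply: divr_gt0; apply: mulr_gt0; rewrite ?sqrtr_gt0.
have s2 : s ^+ 2 * (9 * L) = G ^+ 2.
  rewrite -[L in LHS](sqr_sqrtr (ltW L0)) /s.
  by field; rewrite gt_eqF// sqrtr_gt0.
have delta2 : 16 * k%:R * delta ^+ 2 = m%:R * s ^+ 2.
  rewrite -[k%:R](sqr_sqrtr (ltW k0)) -[m%:R in RHS](sqr_sqrtr (ltW mR0)) /delta.
  by field; rewrite gt_eqF// sqrtr_gt0.
apply: (@le_trans _ _ (delta * r / 2)%:E).
  rewrite lee_fin.
  apply: (@le_trans _ _ (1 / 24 * (G * r / Num.sqrt k%:R) *
    (Num.sqrt m%:R / Num.sqrt L))).
    rewrite ler_wpM2l//.
      by rewrite !mulr_ge0 ?invr_ge0 ?sqrtr_ge0// ltW.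
    (* [m] is [k] or [d], so the term at [m] is one of the two arguments of the minimum. *)
    by rewrite /L /m /minn; case: ifP => _; rewrite ge_min lexx ?orbT.
  rewrite le_eqVlt; apply/orP; left; apply/eqP; rewrite /delta /s.
  by field; rewrite !gt_eqF ?sqrtr_gt0.
apply: le_ereal_inf_tmp => _ [A ->].
have drift : 16 * k%:R * delta ^+ 2 <= m%:R * s ^+ 2 by rewrite delta2.
have [i gap_i] := exists_gap md m0 hr A s0 delta0 drift.
apply: (le_trans gap_i); apply: ereal_sup_ubound.
exists (inner, sample_law d s (axis ((-1) ^+ i.1 * delta) i.2)) => //.
split => //=.
apply: (le_trans (norm_infty_sample_law m0 s _ i.2 L1)).
rewrite lee_fin exprMn sqrr_sign mul1r -s2 -/L.
have mkR : m%:R <= k%:R :> R by rewrite ler_nat.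
(* As [m <= k]; then [2 delta^2 <= s^2 / 8 <= s^2 L], which closes the moment constraint. *)
have d2 : 16 * delta ^+ 2 <= s ^+ 2.
  rewrite -(ler_pM2l k0) mulrCA mulrA delta2.
  by rewrite ler_pM2r ?exprn_gt0.
have := sqr_ge0 s; have := ler_wpM2l (sqr_ge0 s) L1; lra.
Qed.
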